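(* Let $\ell=(l_1,l_2,\ldots,l_m)$ be a segment sequence and let $\mathcal{T}_{\ell}$ be the set of trees with segment sequence $\ell$. Then for any $k$, the starlike tree with segment sequence $\ell$ minimizes the Steiner $k$-Wiener index among the trees in $\mathcal{T}_{\ell}$; that is, if $T^*\in\mathcal{T}_\ell$ is the starlike tree, then $SW_k(T^* )\le SW_k(T)$ for every $T\in\mathcal{T}_\ell$.
   Context: All graphs are finite and simple. For a connected graph $G$ and $S\subseteq V(G)$, the Steiner distance $d(S)$ is the minimum size (number of edges) of a connected subgraph of $G$ whose vertex set contains $S$. The Steiner $k$-Wiener index is $SW_k(G)=\sum_{S\subseteq V(G),\,|S|=k} d(S)$, where $k$ is a positive integer. A branch vertex of a tree is a vertex of degree at least 3. A segment of a tree $T$ is a subpath $P$ of $T$ such that all internal vertices of $P$ have degree 2 in $T$ and each end of $P$ is either a leaf or a branch vertex of $T$. The length of a segment is its number of edges. The segment sequence of $T$ is the sequence $(l_1,l_2,\ldots,l_m)$ of the lengths of all segments of $T$, in non-increasing order. All trees with segment sequence $\ell$ have the same order $n=1+\sum_i l_i$. The starlike tree with segment sequence $\ell$ is the tree obtained from $m$ paths of lengths $l_1,\ldots,l_m$ by identifying one end of each path in a single common vertex. *)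

(* Defs.v *)
From mathcomp Require Import all_boot.
Set Implicit Arguments.
Unset Strict Implicit.
Unset Printing Implicit Defensive.

Record sgraph := SGraph {
  vertex :> finType;
  adj : rel vertex;
  adj_sym : symmetric adj;
  adj_irr : irreflexive adj }.

Section Graphs.
Variable G : sgraph.

Definition edges : {set {set G}} :=
  [set [set x; y] | x : G, y : G in adj x].

Definition degree (x : G) : nat := #|[set y | adj x y]|.
Definition leaf (x : G) : bool := degree x == 1.
Definition branch (x : G) : bool := 3 <= degree x.

(* A subgraph is a pair of a vertex set and an edge set. *)
Definition is_subgraph (H : {set G} * {set {set G}}) : bool :=
  (H.2 \subset edges) && [forall e in H.2, e \subset H.1].

Definition subgraph_connected (H : {set G} * {set {set G}}) : bool :=
  (H.1 != set0) &&
  [forall x in H.1, forall y in H.1,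
     connect [rel u v | [set u; v] \in H.2] x y].

Definition connected : Prop :=
  0 < #|G| /\ forall x y : G, connect (@adj G) x y.

Definition acyclic : Prop :=
  forall c : seq G, 3 <= size c -> ~~ (cycle (@adj G) c && uniq c).

Definition is_tree : Prop := connected /\ acyclic.

(* If G is connected then G itself, the default of the arg min, is admissible,
   so this is a genuine minimum. *)
Definition steiner_distance (S : {set G}) : nat :=
  #|[arg min_(H < ([set: G], edges)
       | [&& is_subgraph H, subgraph_connected H & S \subset H.1]) #|H.2| ].2|.

Definition steiner_wiener (k : nat) : nat :=
  \sum_(S : {set G} | #|S| == k) steiner_distance S.

Definition is_segment (x : G) (p : seq G) : bool :=
  [&& p != [::], path (@adj G) x p, uniq (x :: p),
      all (fun v => degree v == 2) (behead (belast x p)),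
      leaf x || branch x
    & leaf (last x p) || branch (last x p)].

Definition path_edges (x : G) (p : seq G) : {set {set G}} :=
  [set:: pairmap (fun u v => [set u; v]) x p].

(* A segment is recorded by its set of edges, so that a path and its reversal
   are the same segment. The bound #|G| on the size of p is harmless since
   x :: p is duplicate-free. *)
Definition segments : {set {set {set G}}} :=
  [set F | [exists x : G, exists p : #|G|.-bseq G,
     is_segment x p && (F == path_edges x p)]].

Definition segment_sequence : seq nat :=
  sort geq [seq #|F| | F : {set {set G}} <- enum segments].

End Graphs.

(* The class of trees with segment sequence l. *)
Definition tree_class (l : seq nat) (G : sgraph) : Prop :=
  is_tree G /\ segment_sequence G = l.

Section Starlike.
Variable l : seq nat.

(* None is the common vertex; Some (Tagged _ j) with tag i is the vertex at
   distance j + 1 from it on the i-th path. *)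
Definition starlike_vertex : finType :=
  option {i : 'I_(size l) & 'I_(nth 0 l i)}.

Definition starlike_succ (u v : starlike_vertex) : bool :=
  match u, v with
  | None, Some b => tagged b == 0 :> nat
  | Some a, Some b =>
      (tag a == tag b) && (nat_of_ord (tagged b) == (tagged a).+1)
  | _, None => false
  end.

Definition starlike_adj : rel starlike_vertex :=
  fun u v => starlike_succ u v || starlike_succ v u.

Lemma starlike_adj_sym : symmetric starlike_adj.
Proof. by move=> u v; rewrite /starlike_adj orbC. Qed.

Lemma starlike_adj_irr : irreflexive starlike_adj.
Proof.
by case=> [a|] //; rewrite /starlike_adj /= eqxx /= orbb ltn_eqF.
Qed.

Definition starlike : sgraph := SGraph starlike_adj_sym starlike_adj_irr.

End Starlike.

(* Main.v *)
Require Import Defs.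
From mathcomp Require Import all_boot zify.

(** Deleting an edge [e] of a tree leaves two components, and a connected
    subgraph containing [S] must use [e] exactly when [S] meets both. So the
    Steiner distance of [S] is the number of edges that separate [S]
    ([tree_steiner_distance]), and SW_k is the sum over the edges [e] of the
    number of k-sets separated by [e]. If the components have [a] and [n - a]
    vertices, this number is C(n,k) - C(a,k) - C(n-a,k) ([sep_countE]).

    The segments partition the edges. Along a segment of length [l] every inner
    vertex has degree 2, so the component behind the current edge gains exactly
    one vertex at each step: its sizes are a, a+1, ..., a+l-1 for some positive
    [a] with a + l <= n ([path_sep_count]). As C(.,k) is convex, the
    contribution of the segment is smallest when this window is at an extreme
    position ([sum_one_sided_le]), and that happens when an end of the segment
    is a leaf. The resulting lower bound depends only on [n], [k] and [l], and
    [n] is one more than the sum of the segment lengths. Every segment of a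
    starlike tree ends at a leaf, so there the lower bound is attained
    segment by segment.

    That the starlike tree has the prescribed segment sequence requires its
    centre not to have degree 2: otherwise two legs would merge into one
    segment. It holds because no tree has exactly two segments
    ([card_segments_neq2]). *)

Set Implicit Arguments.
Unset Strict Implicit.
Unset Printing Implicit Defensive.

(** * Edge deletion and bridges *)

Definition del_edge (G : sgraph) (e : {set G}) : rel G :=
  [rel u v | adj u v && ([set u; v] != e)].

Definition side (G : sgraph) (x y : G) : {set G} :=
  [set z | connect (del_edge [set x; y]) x z].

Definition separates (G : sgraph) (e S : {set G}) : bool :=
  [exists x in S, exists y in S, ~~ connect (del_edge e) x y].

Lemma set2_inj (T : finType) (a b c d : T) :
  [set a; b] = [set c; d] -> (a = c /\ b = d) \/ (a = d /\ b = c).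
Proof.
move=> E.
have := set21 a b; have := set22 a b; have := set21 c d; have := set22 c d.
rewrite {1 2}E -{1 2}E !inE.
do 4!case/orP=> /eqP ?; subst; auto.
Qed.

Lemma edgesP (G : sgraph) (e : {set G}) :
  reflect (exists x y : G, adj x y /\ e = [set x; y]) (e \in edges G).
Proof.
apply: (iffP imset2P) => [[x y _ xy ->]|[x [y [xy ->]]]]; first by exists x, y.
by exists x y => //; rewrite inE.
Qed.

Lemma adj_edge (G : sgraph) (x y : G) : adj x y -> [set x; y] \in edges G.
Proof. by move=> xy; apply/edgesP; exists x, y. Qed.

Lemma edge_adj (G : sgraph) (x y : G) : [set x; y] \in edges G -> adj x y.
Proof.
by case/edgesP=> a [b [ab /set2_inj [[-> ->]|[-> ->]]]] //; rewrite adj_sym.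
Qed.

Lemma adj_neq (G : sgraph) (x y : G) : adj x y -> x != y.
Proof. by apply: contraTneq => ->; rewrite adj_irr. Qed.

Lemma del_edge_sym (G : sgraph) (e : {set G}) : symmetric (del_edge e).
Proof. by move=> x y; rewrite /del_edge /= adj_sym setUC. Qed.

Lemma connect_del_sym (G : sgraph) (e : {set G}) :
  connect_sym (del_edge e).
Proof. exact/sym_connect_sym/del_edge_sym. Qed.

Lemma path_avoiding (G : sgraph) (e : {set G}) z x p :
  z \in e -> path (@adj G) x p -> z \notin x :: p -> path (del_edge e) x p.
Proof.
move=> ze xp zp; apply: (sub_in_path (P := predC1 z)) xp.
  move=> u v; rewrite !inE => uz vz uv; rewrite /del_edge /= uv /=.
  by apply: contraTneq ze => <-; rewrite !inE negb_or !(eq_sym z) uz.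
by apply/allP=> u up; rewrite inE; apply: contraNneq zp => <-.
Qed.

(** Otherwise the edge closes a path that avoids it into a cycle. *)
Lemma acyclic_bridge (G : sgraph) (x y : G) :
  acyclic G -> adj x y -> ~~ connect (del_edge [set x; y]) x y.
Proof.
move=> acG xy; apply/negP=> /connectP[p xp yE].
case/shortenP: xp yE => q xq uq _ yE.
have qs : 2 <= size q.
  case: q xq uq yE => [|a [|b q]] //= xq _ yE.
    by rewrite yE adj_irr in xy.
  by move: xq; rewrite -yE /del_edge /= eqxx andbF.
have := acG (x :: q) (leq_ltn_trans qs (ltnSn _)).
rewrite uq andbT /= rcons_path -yE adj_sym xy andbT; case/negP.
by apply: sub_path xq => u v /andP[].
Qed.

(** On a cycle, the edge between the first two vertices is bypassed by the rest
    of the cycle. *)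
Lemma bridges_acyclic (G : sgraph) :
  (forall x y : G, adj x y -> ~~ connect (del_edge [set x; y]) x y) ->
  acyclic G.
Proof.
move=> br [|x [|y p]] // sp; apply/negP=> /andP[cyc uq].
have xy : adj x y by case/andP: cyc.
have /negP[] := br _ _ xy.
rewrite connect_del_sym; apply/connectP; exists (rcons p x); last first.
  by rewrite last_rcons.
case: p sp cyc uq => // z p _ cyc uq.
move: cyc => /= /andP[_]; rewrite rcons_path => /and3P[yz zp px].
move: uq => /= /and3P[]; rewrite !inE !negb_or => /and3P[nxy nxz xp].
case/andP=> nyz yp _.
rewrite /del_edge rcons_path /= yz px /=.
apply/and3P; split.
- by apply/eqP=> /set2_inj [] [] A B; subst; rewrite eqxx in nxy nxz.
- apply: (path_avoiding (set21 x y)) => //.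
  by rewrite inE negb_or nxz.
apply/eqP=> /set2_inj [] [lE xE]; first by rewrite xE eqxx in nxy.
by have := mem_last z p; rewrite lE inE (negPf nyz) (negPf yp).
Qed.

Lemma side_self (G : sgraph) (x y : G) : x \in side x y.
Proof. by rewrite inE connect0. Qed.

Lemma side_opp (G : sgraph) (x y : G) :
  is_tree G -> adj x y -> y \notin side x y.
Proof. by case=> _ acG xy; rewrite inE acyclic_bridge. Qed.

(** The union of the two sides is closed under adjacency: the deleted edge joins
    one side to the other, and every other edge stays within a side. *)
Lemma in_sides (G : sgraph) (x y z : G) :
  connected G -> adj x y -> (z \in side x y) || (z \in side y x).
Proof.
case=> _ cG xy; set A := side x y :|: side y x.
suff cl : closed (@adj G) (mem A).
  have : z \in A by rewrite -(closed_connect cl (cG x z)) inE side_self.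
  by rewrite inE.
apply: intro_closed => [|u v uv]; first exact/sym_connect_sym/adj_sym.
rewrite !inE (setUC [set y]); have [E _|ne] := eqVneq [set u; v] [set x; y].
  by case/set2_inj: E => [] [_ ->]; rewrite connect0 ?orbT.
have uv' : connect (del_edge [set x; y]) u v.
  by apply: connect1; rewrite /del_edge /= uv.
by case/orP=> h; rewrite (connect_trans h uv') ?orbT.
Qed.

Lemma sideC (G : sgraph) (x y : G) :
  is_tree G -> adj x y -> side y x = ~: side x y.
Proof.
move=> [cG acG] xy; apply/setP=> z; rewrite in_setC.
have := in_sides z cG xy; case: (boolP (z \in side x y)) => [xz _|_ /= ->] //.
apply/negbTE/negP=> yz; have /negP[] := acyclic_bridge acG xy.
move: xz yz; rewrite !inE (setUC [set y]) => xz yz.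
by apply: (connect_trans xz); rewrite connect_del_sym.
Qed.

(** A set closed under the remaining adjacency contains a component as soon as
    it meets it; since there are only two components, it suffices to know one
    point inside and one outside. *)
Lemma side_eq (G : sgraph) (x y : G) (A : {set G}) :
  connected G -> adj x y -> x \in A -> y \notin A ->
  (forall u v, u \in A -> del_edge [set x; y] u v -> v \in A) ->
  side x y = A.
Proof.
move=> cG xy xA yA clA.
have cl : closed (del_edge [set x; y]) (mem A).
  by apply: intro_closed => [|u v uv uA]; [exact: connect_del_sym|exact: clA uv].
apply/setP=> z; apply/idP/idP => [|zA].
  by rewrite inE => /(closed_connect cl) <-.
case/orP: (in_sides z cG xy) => //; rewrite inE setUC => /(closed_connect cl).
by rewrite zA (negPf yA).
Qed.

Lemma side_gt0 (G : sgraph) (x y : G) : 0 < #|side x y|.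
Proof. by apply/card_gt0P; exists x; exact: side_self. Qed.

(** * Steiner distance in a tree *)

(** Every edge of a duplicate-free path in a tree separates the ends of the
    path: the rest of the path joins them to the ends of that edge, which is a
    bridge. *)
Lemma tree_path_separates (G : sgraph) (x : G) p :
  acyclic G -> path (@adj G) x p -> uniq (x :: p) ->
  path [rel u v | adj u v && ~~ connect (del_edge [set u; v]) x (last x p)] x p.
Proof.
move=> acG; elim: p x => [//|y p IH] x /= /andP[xy yp] /andP[xyp uq].
have xyp' := xyp; move: xyp'; rewrite inE negb_or => /andP[nxy xp].
rewrite xy /=; apply/andP; split.
  apply: contra (acyclic_bridge acG xy) => h.
  apply: (connect_trans h); rewrite connect_del_sym.
  apply/connectP; exists p => //.
  exact: path_avoiding (set21 x y) yp xyp.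
apply: (sub_in_path (P := mem (y :: p))) (IH _ yp uq); last exact/allP.
move=> u v up vp /= /andP[-> /= nc]; apply: contra nc => h.
apply: connect_trans h; rewrite connect_del_sym; apply: connect1.
rewrite /del_edge /= xy; apply: contraNneq xyp => E.
by have := set21 x y; rewrite E !inE => /orP[] /eqP ->.
Qed.

Lemma uniq_path_between (G : sgraph) (x y : G) :
  connected G -> exists p, [/\ path (@adj G) x p, uniq (x :: p) & y = last x p].
Proof.
case=> _ /(_ x y) /connectP[p xp ->].
by case/shortenP: xp => q xq uq _; exists q.
Qed.

Definition cut_edges (G : sgraph) (S : {set G}) : {set {set G}} :=
  [set e in edges G | separates e S].

Lemma separatesP (G : sgraph) (e S : {set G}) :
  reflect (exists x y, [/\ x \in S, y \in S & ~~ connect (del_edge e) x y])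
          (separates e S).
Proof.
apply: (iffP exists_inP) => [[x xS /exists_inP[y yS n]]|[x [y [xS yS n]]]].
  by exists x, y.
by exists x => //; apply/exists_inP; exists y.
Qed.

Definition connects (G : sgraph) (S : {set G}) (H : {set G} * {set {set G}}) :=
  [&& is_subgraph H, subgraph_connected H & S \subset H.1].

Lemma connects_whole (G : sgraph) (S : {set G}) :
  connected G -> connects S ([set: G], edges G).
Proof.
case=> G0 cG; rewrite /connects /is_subgraph /subgraph_connected /=.
rewrite subxx subsetT andbT /=; apply/and3P; split.
- by apply/forall_inP=> e _; rewrite subsetT.
- by rewrite -card_gt0 cardsT.
apply/forall_inP=> x _; apply/forall_inP=> y _.
by apply: connect_sub (cG x y) => u v uv; apply: connect1; apply: adj_edge.
Qed.

(** A connected subgraph that misses a separating edge would join, within the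
    graph without that edge, two vertices that it separates. *)
Lemma cut_edges_sub (G : sgraph) (S : {set G}) H :
  connects S H -> cut_edges S \subset H.2.
Proof.
case/and3P=> /andP[He _] /andP[_ /forall_inP Hc] /subsetP SH.
apply/subsetP=> e; rewrite inE => /andP[eE /separatesP[x [y [xS yS]]]].
apply: contraR => eH.
have /forall_inP/(_ _ (SH _ yS)) := Hc _ (SH _ xS).
apply: connect_sub => u v /= uv; apply: connect1.
rewrite /del_edge /= edge_adj ?(subsetP He) //=.
by apply: contraNneq eH => <-.
Qed.

(** The separating edges alone form a connected subgraph: they include the
    whole path between any two vertices of [S], and each of them lies on such a
    path. *)
Lemma cut_edges_connects (G : sgraph) (S : {set G}) :
  is_tree G -> S != set0 ->
  connects S (S :|: cover (cut_edges S), cut_edges S).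
Proof.
move=> [cG acG] /set0Pn[s sS]; rewrite /connects /is_subgraph /=.
rewrite /subgraph_connected /= subsetUl andbT.
set E := cut_edges S; set r := (X in connect X).
have r_sym : connect_sym r.
  by apply: sym_connect_sym => u v; rewrite /r /= setUC.
have in_path x p : path (@adj G) x p -> uniq (x :: p) -> x \in S ->
    last x p \in S -> path r x p.
  move=> xp uq xS yS; apply: sub_path (tree_path_separates acG xp uq).
  move=> u v /= /andP[uv n]; rewrite /r /= inE adj_edge //=.
  by apply/separatesP; exists x, (last x p).
have inS x y : x \in S -> y \in S -> connect r x y.
  move=> xS yS; have [p [xp uq yE]] := uniq_path_between x y cG.
  by apply/connectP; exists p => //; apply: in_path; rewrite -?yE.
have to_s z : z \in S :|: cover E -> connect r s z.
  case/setUP=> [zS|]; first exact: inS.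
  case/bigcupP=> e; rewrite inE => /andP[_ /separatesP[x [y [xS yS nxy]]]] ze.
  have [p [xp uq yE]] := uniq_path_between x y cG.
  have zp : z \in x :: p.
    apply: contraR nxy => zp; apply/connectP; exists p => //.
    exact: path_avoiding ze xp zp.
  apply: (connect_trans (inS _ _ sS xS)).
  have xpr : path r x p by apply: in_path; rewrite -?yE.
  case/splitPl: zp xpr => p1 p2 lE; rewrite cat_path => /andP[xp1 _].
  by apply/connectP; exists p1.
apply/and3P; split.
- apply/andP; split; first by apply/subsetP=> e; rewrite inE => /andP[].
  apply/forall_inP=> e eE; apply: subsetU; apply/orP; right.
  exact: (bigcup_max e).
- by apply/set0Pn; exists s; rewrite inE sS.
apply/forall_inP=> x /to_s sx; apply/forall_inP=> y /to_s sy.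
by apply: (connect_trans _ sy); rewrite r_sym.
Qed.

Lemma tree_steiner_distance (G : sgraph) (S : {set G}) :
  is_tree G -> S != set0 -> steiner_distance S = #|cut_edges S|.
Proof.
move=> tG S0; have [cG _] := tG; rewrite /steiner_distance.
case: arg_minnP => [|H HS Hmin]; first exact: connects_whole.
apply/eqP; rewrite eqn_leq (Hmin _ (cut_edges_connects tG S0)) /=.
exact: subset_leq_card (cut_edges_sub HS).
Qed.

Definition sep_count (G : sgraph) (k : nat) (e : {set G}) : nat :=
  #|[set S : {set G} | (#|S| == k) && separates e S]|.

(** Double counting of the pairs of a [k]-set and an edge separating it. *)
Lemma tree_steiner_wiener (G : sgraph) (k : nat) :
  is_tree G -> 0 < k -> steiner_wiener G k = \sum_(e in edges G) sep_count k e.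
Proof.
move=> tG k0; rewrite /steiner_wiener.
transitivity (\sum_(S : {set G} | #|S| == k)
                \sum_(e in edges G) (separates e S : nat)).
  apply: eq_bigr => S /eqP Sk.
  rewrite tree_steiner_distance -?card_gt0 ?Sk // /cut_edges -sum1dep_card.
  by rewrite big_mkcondr; apply: eq_bigr => e _; case: separates.
rewrite exchange_big; apply: eq_bigr => e _.
rewrite /sep_count -sum1dep_card big_mkcondr.
by apply: eq_bigr => S _; case: separates.
Qed.

(** The number of nonempty [k]-sets that lie within one of the two components
    left by a bridge, when one component has [a] of the [n] vertices. *)
Definition one_sided (n k a : nat) : nat := 'C(a, k) + 'C(n - a, k).

(** A bridge fails to separate exactly the sets lying on one of its sides, and a
    nonempty set cannot lie on both. *)
Lemma sep_countE (G : sgraph) (x y : G) (k : nat) :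
  is_tree G -> adj x y -> 0 < k ->
  sep_count k [set x; y] + one_sided #|G| k #|side x y| = 'C(#|G|, k).
Proof.
move=> tG xy k0; set A := side x y.
have sepE (S : {set G}) :
    separates [set x; y] S = ~~ ((S \subset A) || (S \subset ~: A)).
  apply/separatesP/idP => [[u [v [uS vS]]]|].
    apply: contra => /orP[] /subsetP sub.
      have := sub _ uS; have := sub _ vS; rewrite !inE => xv xu.
      by rewrite (connect_trans _ xv) // connect_del_sym.
    have := sub _ uS; have := sub _ vS; rewrite -sideC // !inE setUC => xv xu.
    by rewrite (connect_trans _ xv) // connect_del_sym.
  rewrite negb_or => /andP[/subsetPn[v vS vA] /subsetPn[u uS uA]].
  rewrite inE negbK in uA; exists u, v; split=> //.
  move: vA uA; rewrite !inE => xv xu; apply: contra xv.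
  exact: connect_trans.
rewrite /sep_count /one_sided.
have -> : #|G| - #|A| = #|~: A| by rewrite -(cardsC A) addKn.
rewrite -!cards_draws -card_draws.
set X := [set B | _]; set Y := [set B : {set G} | _]; set Z := [set B | _].
have YZ0 : Y :&: Z = set0.
  apply/setP=> S; rewrite !inE; apply/negP=> /andP[/andP[SA /eqP Sk]].
  case/andP=> SB _; move: k0; rewrite -Sk card_gt0 => /set0Pn[u uS].
  by have := subsetP SB _ uS; rewrite inE (subsetP SA).
have XE : X = [set B : {set G} | #|B| == k] :\: (Y :|: Z).
  apply/setP=> S; rewrite !inE sepE; case: (_ == k); rewrite ?andbF ?andbT //.
rewrite -[#|Y| + #|Z|]subn0 -[in X in _ - X](cards0 {set G}) -YZ0 -cardsU XE.
rewrite cardsDS ?subnK //; first apply: subset_leq_card.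
  by apply/subsetP=> S; rewrite !inE => /orP[] /andP[].
by apply/subsetP=> S; rewrite !inE => /orP[] /andP[].
Qed.

(** * The number of edges of a tree *)

Lemma degree_gt0 (G : sgraph) (a b z : G) :
  connected G -> adj a b -> 0 < degree z.
Proof.
move=> cG ab; apply/card_gt0P.
have [[|w p] [/= zp _ aE]] := uniq_path_between z a cG.
  by exists b; rewrite inE -aE.
by exists w; rewrite inE; case/andP: zp.
Qed.

(** Sending each vertex [v] other than a root [r] to the first edge of the path
    from [v] to [r] is a bijection onto the edges. *)
Lemma tree_order (G : sgraph) : is_tree G -> #|G| = #|edges G|.+1.
Proof.
move=> tG; have [cG acG] := tG; have [r _] : {r : G | true}.
  by case: cG => /card_gt0P/sigW[r _] _; exists r.
pose par v w := adj v w && connect (del_edge [set v; w]) w r.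
have par_uniq v : v != r -> exists2 w, par v w & forall w', par v w' -> w' = w.
  move=> vr; have [[|w p] [/= vp uq rE]] := uniq_path_between v r cG.
    by rewrite rE eqxx in vr.
  case/andP: vp => vw wp; case/andP: uq => vwp _; exists w.
    rewrite /par vw; apply/connectP; exists p => //.
    exact: path_avoiding (set21 v w) wp vwp.
  move=> w' /andP[vw' h]; apply/eqP; apply: contraT => ne.
  case/negP: (acyclic_bridge acG vw'); rewrite connect_del_sym.
  apply: (connect_trans h); rewrite connect_del_sym.
  apply: (@connect_trans _ _ w).
    apply: connect1; rewrite /del_edge /= vw; apply/eqP=> /set2_inj [] [] E1 E2.
      by rewrite E2 eqxx in ne.
    by have := adj_neq vw; rewrite E2 eqxx.
  apply/connectP; exists p => //.
  exact: path_avoiding (set21 v w') wp vwp.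
pose up v := [set v; odflt v [pick w | par v w]].
have upE v w : v != r -> par v w -> up v = [set v; w].
  move=> vr vw; rewrite /up; case: pickP => [w' vw'|/(_ w)]; last by rewrite vw.
  by have [w0 _ w0E] := par_uniq _ vr; rewrite /= (w0E _ vw) (w0E _ vw').
have -> : edges G = up @: [set~ r].
  apply/setP=> e; apply/edgesP/imsetP => [[x [y [xy ->]]]|[v]].
    have rside u w : adj u w -> par u w -> u != r.
      move=> uw /andP[_ wr]; apply: contraNneq (acyclic_bridge acG uw) => ur.
      by rewrite connect_del_sym {2}ur.
    case/orP: (in_sides r cG xy); rewrite inE => h.
      have yx : par y x by rewrite /par adj_sym xy setUC.
      exists y; first by rewrite !inE (rside _ x) // adj_sym.
      by rewrite (upE _ x) ?(setUC [set y]) // (rside _ x) // adj_sym.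
    have pxy : par x y by rewrite /par xy setUC.
    exists x; first by rewrite !inE (rside _ y).
    by rewrite (upE _ y) // (rside _ y).
  rewrite !inE => vr ->; have [w vw _] := par_uniq _ vr.
  by exists v, w; rewrite (upE _ w) //; case/andP: vw.
rewrite card_in_imset; first by rewrite -(cardsC [set r]) cards1.
move=> v v'; rewrite !inE => vr vr'.
have [w vw _] := par_uniq _ vr; have [w' vw' _] := par_uniq _ vr'.
rewrite (upE _ _ vr vw) (upE _ _ vr' vw') => /set2_inj [[] //|[E1 E2]].
subst v' w'; case/andP: vw' => _; case/andP: vw => vw wr rv.
case/negP: (acyclic_bridge acG vw); rewrite connect_del_sym.
by apply: (connect_trans wr); rewrite connect_del_sym setUC.
Qed.

(** * Convexity of binomial coefficients *)

(** By Pascal's rule, moving the pair apart by one step changes the sum by a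
    difference of two values of C(., k - 1), which is monotone. *)
Lemma bin_convex a b c d k :
  a + b = c + d -> c <= a -> c <= b -> 'C(a, k) + 'C(b, k) <= 'C(c, k) + 'C(d, k).
Proof.
move=> E ca cb; have -> : d = c + (a - c) + (b - c) by lia.
rewrite -{1}(subnKC ca) -{1}(subnKC cb).
move: (a - c) (b - c) => i j {a b d E ca cb}.
elim: i => [|i IH]; first by rewrite addn0.
case: k IH => [|k] IH; first by rewrite !bin0.
have := leq_bin2l k (leq_addr j (c + i)).
rewrite !addnS !addSn !binS; lia.
Qed.

(** Reversing the order of the complementary sizes turns both sums into sums of
    pairs: the j-th pair is (a + j, b + j) with a + b = n - l + 1 on the left,
    and the pair (n - l + j, 1 + j), with the same sum but further apart, on
    the right. *)
Lemma sum_one_sided_le n k l a : 0 < a -> a + l <= n ->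
  \sum_(j < l) one_sided n k (a + j) <= \sum_(j < l) one_sided n k (n - l + j).
Proof.
move=> a0 aln.
have flip m : l <= m -> \sum_(j < l) 'C(m - j, k) = \sum_(j < l) 'C(m - l + j.+1, k).
  move=> lm; rewrite (reindex_inj rev_ord_inj) /=; apply: eq_bigr => j _.
  by congr 'C(_, _); have := ltn_ord j; lia.
rewrite /one_sided !big_split /=.
under [X in _ + X <= _]eq_bigr do rewrite subnDA.
rewrite flip; last lia.
under [X in _ <= _ + X]eq_bigr do rewrite subnDA.
rewrite flip; last lia.
rewrite -!big_split /=; apply: leq_sum => j _.
rewrite addnC [X in _ <= X]addnC; apply: bin_convex; lia.
Qed.

(** * Segments *)

Lemma path_edgesP (G : sgraph) (x : G) p e :
  reflect (exists p1 v p2, p = p1 ++ v :: p2 /\ e = [set last x p1; v])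
          (e \in path_edges x p).
Proof.
rewrite inE; apply: (iffP idP) => [|[p1 [v [p2 [-> ->]]]]]; last first.
  by rewrite pairmap_cat /= mem_cat inE eqxx orbT.
elim: p x => [//|y p IH] x /=; rewrite inE => /orP[/eqP->|].
  by exists [::], y, p.
by case/IH=> p1 [v [p2 [-> ->]]]; exists (y :: p1), v, p2.
Qed.

Lemma path_edges_vertex (G : sgraph) (x : G) p e v :
  e \in path_edges x p -> v \in e -> v \in x :: p.
Proof.
case/path_edgesP=> p1 [w [p2 [-> ->]]]; rewrite !inE => /orP[] /eqP->.
  have := mem_last x p1; rewrite inE mem_cat => /orP[] -> //.
  by rewrite orbT.
by rewrite mem_cat inE eqxx !orbT.
Qed.

Lemma uniq_path_edges (G : sgraph) (x : G) p :
  uniq (x :: p) -> uniq (pairmap (fun u v => [set u; v]) x p).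
Proof.
elim: p x => [//|y p IH] x /andP[xp uq] /=; rewrite IH // andbT.
apply: contra xp => h; apply: (@path_edges_vertex _ y p [set x; y]).
  by rewrite inE.
exact: set21.
Qed.

Lemma card_path_edges (G : sgraph) (x : G) p :
  uniq (x :: p) -> #|path_edges x p| = size p.
Proof.
move/uniq_path_edges=> uq; rewrite cardsE (card_uniqP uq) size_pairmap //.
Qed.

Lemma path_edges_sub (G : sgraph) (x : G) p :
  path (@adj G) x p -> path_edges x p \subset edges G.
Proof.
move=> xp; apply/subsetP=> e /path_edgesP[p1 [v [p2 [pE ->]]]].
by move: xp; rewrite pE cat_path /= => /and3P[_ h _]; exact: adj_edge.
Qed.

Lemma degree2_nbrs (G : sgraph) (v a b c : G) :
  degree v = 2 -> adj v a -> adj v b -> a != b -> adj v c -> c = a \/ c = b.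
Proof.
move=> dv va vb ab vc.
have /eqP E : [set a; b] == [set y | adj v y].
  rewrite eqEcard cards2 ab -/(degree v) dv leqnn andbT.
  by apply/subsetP=> z; rewrite !inE => /orP[] /eqP->.
have : c \in [set a; b] by rewrite E inE.
by rewrite !inE => /orP[] /eqP; auto.
Qed.

(** * Segments as classes of edges *)

(** The segments of a tree are the classes of the equivalence relation that this
    relation generates on the edges. *)
Definition linked (G : sgraph) : rel {set G} :=
  [rel e f | [&& e \in edges G, f \in edges G &
                 [exists v, [&& degree v == 2, v \in e & v \in f]]]].

Lemma connect_linked_sym (G : sgraph) : connect_sym (@linked G).
Proof.
apply: sym_connect_sym => e f; rewrite /linked /= andbCA; congr [&& _, _ & _].
by apply: eq_existsb => v; rewrite [(v \in e) && _]andbC.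
Qed.

Lemma deg2_path_linked (G : sgraph) (x y : G) p e :
  path (@adj G) x (y :: p) -> all (fun v => degree v == 2) (belast y p) ->
  e \in path_edges x (y :: p) -> connect (@linked G) [set x; y] e.
Proof.
elim: p x y => [|z p IH] x y /=.
  by move=> _ _; rewrite inE /= inE => /eqP ->; rewrite connect0.
case/and3P=> xy yz zp /andP[dy dp].
rewrite inE /= inE => /orP[/eqP->|]; first by rewrite connect0.
move=> he; apply: (@connect_trans _ _ [set y; z]).
  apply: connect1; rewrite /linked /= !adj_edge //=; apply/existsP; exists y.
  by rewrite dy set21 set22.
by apply: IH; rewrite /= ?yz // inE.
Qed.

(** A vertex of degree 2 on a segment is not an end of it, so the segment
    passes through both edges at that vertex. *)
Lemma segment_closed (G : sgraph) (x : G) p :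
  is_segment x p -> closed (@linked G) (mem (path_edges x p)).
Proof.
case/and5P=> p0 xp uq dp /andP[dx dl].
apply: intro_closed => [|e f /and3P[_ fE /existsP[v /and3P[/eqP dv ve vf]]] eP].
  exact: connect_linked_sym.
have vp := path_edges_vertex eP ve.
have {}vp : v \in p.
  move: vp; rewrite inE => /orP[/eqP vx|//].
  by move: dx; rewrite -vx /leaf /branch dv.
have [c [vc fc]] : exists c, adj v c /\ f = [set v; c].
  case/edgesP: fE vf => a [b [ab ->]]; rewrite !inE => /orP[] /eqP->.
    by exists b.
  by exists a; rewrite adj_sym setUC.
case/splitPr: vp xp uq dl => p1 [|w p2] xp uq dl.
  by move: dl; rewrite last_cat /= /leaf /branch dv.
move: xp; rewrite cat_path /= => /and4P[_ uv vw _].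
have uw : last x p1 != w.
  apply: contraTneq uq => E; rewrite -cat_cons cat_uniq.
  apply/and3P=> -[_ /hasPn /(_ w)]; rewrite !inE eqxx orbT => /(_ isT).
  by rewrite -E -(in_cons x p1) mem_last.
have vu : adj v (last x p1) by rewrite adj_sym.
rewrite fc; apply/path_edgesP.
have [->|->] := degree2_nbrs dv vu vw uw vc.
  by exists p1, v, (w :: p2); rewrite setUC.
by exists (rcons p1 v), w, p2; rewrite cat_rcons last_rcons.
Qed.

(** Consecutive edges of a segment are linked, and a segment is closed under
    linking; so it is determined by any one of its edges, without regard to the
    direction in which it is traversed. *)
Lemma segment_class (G : sgraph) (x : G) p e :
  is_segment x p -> e \in path_edges x p ->
  path_edges x p = [set f | connect (@linked G) e f].
Proof.
move=> sp ep; apply/setP=> f; rewrite [RHS]inE; apply/idP/idP => [fp|]; last first.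
  by move=> /(closed_connect (segment_closed sp)) <-.
case/and5P: sp ep fp => p0 xp _ dp _; case: p p0 xp dp => // y p _ xp dp ep fp.
apply: (@connect_trans _ _ [set x; y]); last exact: deg2_path_linked fp.
by rewrite connect_linked_sym; apply: deg2_path_linked ep.
Qed.

Lemma uniq_size_leq (T : finType) (s : seq T) : uniq s -> size s <= #|T|.
Proof. by move/card_uniqP <-; exact: max_card. Qed.

Lemma segmentsP (G : sgraph) (F : {set {set G}}) :
  reflect (exists x p, is_segment x p /\ F = path_edges x p) (F \in segments G).
Proof.
rewrite inE; apply: (iffP existsP) => [[x /existsP[p /andP[sp /eqP->]]]|].
  by exists x, p.
move=> [x [p [sp ->]]]; exists x.
have hp : size p <= #|G|.
  have /and5P[_ _ uq _ _] := sp.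
  exact: ltnW (uniq_size_leq uq).
by apply/existsP; exists (Bseq hp); rewrite sp eqxx.
Qed.

(** * Every edge of a tree lies on a segment *)

(** A piece of a segment: its ends may still have degree 2. *)
Definition deg2_path (G : sgraph) (x : G) p : bool :=
  [&& p != [::], path (@adj G) x p, uniq (x :: p)
    & all (fun v => degree v == 2) (behead (belast x p))].

Lemma deg2_path_rev (G : sgraph) (x : G) p : deg2_path x p ->
  [/\ deg2_path (last x p) (rev (belast x p)),
      last (last x p) (rev (belast x p)) = x
    & path_edges x p \subset path_edges (last x p) (rev (belast x p))].
Proof.
case/and4P=> p0 xp uq dp; case/lastP: p p0 xp uq dp => // p y _ xp uq dp.
rewrite last_rcons belast_rcons rev_cons last_rcons; split=> //; last first.
  apply/subsetP=> e /path_edgesP[p1 [v [p2 [pE ->]]]]; apply/path_edgesP.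
  case/lastP: p1 pE => [|p1 u] pE.
    exists (rev p), x, [::]; rewrite cats1; split=> //=.
    case: p pE {xp uq dp} => [[->] |z p [-> _]]; first by rewrite setUC.
    by rewrite rev_cons last_rcons setUC.
  case/lastP: p2 pE => [|p2 w].
    rewrite cats1 => /rcons_inj [pE ->]; exists [::], u, (rcons (rev p1) x).
    by rewrite pE rev_rcons last_rcons setUC.
  rewrite -rcons_cons -rcons_cat => /rcons_inj [pE _].
  exists (rcons (rev p2) v), u, (rcons (rev p1) x).
  rewrite !last_rcons setUC pE rev_cat rev_rcons rev_cons -cats1.
  by rewrite -!cats1 -!catA.
apply/and4P; split.
- by case: (rev p).
- have := rev_path (@adj G) x (rcons p y).
  rewrite last_rcons belast_rcons rev_cons => ->.
  by apply: sub_path xp => u v; rewrite adj_sym.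
- by rewrite -rev_cons -rev_rcons rev_uniq rcons_cons.
by move: dp; rewrite !belast_rcons /= all_rev.
Qed.

Lemma acyclic_no_chord (G : sgraph) (w x y : G) p :
  acyclic G -> path (@adj G) x (y :: p) -> uniq (x :: y :: p) ->
  adj w x -> w != y -> w \notin x :: y :: p.
Proof.
move=> acG xyp uq wx wy; rewrite !inE (negPf (adj_neq wx)) (negPf wy) /=.
apply/negP=> /splitPr wp; case: wp xyp uq => p1 p2 xyp uq.
have /negP[] : ~~ (cycle (@adj G) [:: x, y & rcons p1 w]
                    && uniq [:: x, y & rcons p1 w]).
  by apply: acG; rewrite /= size_rcons.
move: xyp uq; rewrite -cat_rcons => xyp uq.
apply/andP; split.
  move: xyp; rewrite /= cat_path => /and3P[-> h _] /=.
  by rewrite rcons_path h last_rcons wx.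
by move: uq; rewrite -!cat_cons cat_uniq => /and3P[].
Qed.

(** While the starting vertex has degree 2, its other neighbour can be put in
    front; this stops since the vertices of the path remain distinct. *)
Lemma deg2_path_extend (G : sgraph) (x : G) p :
  acyclic G -> deg2_path x p ->
  exists x' p', [/\ deg2_path x' p', degree x' != 2, last x' p' = last x p
    & path_edges x p \subset path_edges x' p'].
Proof.
move=> acG; move: {2}(#|G| - size p) (leqnn (#|G| - size p)) => n.
elim: n x p => [|n IH] x p hn ap.
  have /and4P[_ _ uq _] := ap.
  by move: hn; rewrite leqn0 subn_eq0 leqNgt (uniq_size_leq uq).
have [dx|] := eqVneq (degree x) 2; last by exists x, p.
have /and4P[p0 xp uq dp] := ap.
case: p p0 xp uq dp ap hn => // y p _ xp uq dp ap hn.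
have [w xw wy] : exists2 w, adj x w & w != y.
  have : 0 < #|[set z | adj x z] :\ y|.
    have := cardsD1 y [set z | adj x z]; rewrite -/(degree x) dx inE.
    by case: adj => /=; lia.
  by case/card_gt0P=> w; rewrite !inE => /andP[? ?]; exists w.
have wx : adj w x by rewrite adj_sym.
have wp := acyclic_no_chord acG xp uq wx wy.
have [||x' [p' [? ? lE sub]]] := IH w (x :: y :: p).
- by rewrite /= subnS -ltnS prednK // subn_gt0; exact: uniq_size_leq uq.
- apply/and4P; split=> //; first by rewrite /= wx.
    by rewrite cons_uniq wp.
  by rewrite /= dx eqxx; move: dp.
exists x', p'; split=> //; apply: subset_trans sub.
by apply/subsetP=> e; rewrite inE => ep; rewrite inE in_cons; apply/orP; right.
Qed.

(** Extend the edge at one end, reverse the path, and extend at the other. *)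
Lemma edge_in_segment (G : sgraph) (e : {set G}) :
  is_tree G -> e \in edges G -> exists2 F, F \in segments G & e \in F.
Proof.
move=> [cG acG] /edgesP[x [y [xy ->]]].
have a0 : deg2_path x [:: y] by rewrite /deg2_path /= xy inE adj_neq.
have [x1 [p1 [a1 d1 _ /subsetP s1]]] := deg2_path_extend acG a0.
have [a2 l2 /subsetP s2] := deg2_path_rev a1.
have [x3 [p3 [a3 d3 l3 /subsetP s3]]] := deg2_path_extend acG a2.
exists (path_edges x3 p3); last by apply/s3/s2/s1; rewrite inE /= inE.
apply/segmentsP; exists x3, p3; split=> //.
have endP (z : G) : degree z != 2 -> leaf z || branch z.
  by have := degree_gt0 z cG xy; rewrite /leaf /branch; lia.
by case/and4P: a3 => ? ? ? ?; apply/and5P; split; rewrite // !endP // l3 l2.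
Qed.

Lemma segments_class (G : sgraph) (F : {set {set G}}) e :
  F \in segments G -> e \in F -> F = [set f | connect (@linked G) e f].
Proof. by case/segmentsP=> x [p [sp ->]]; exact: segment_class. Qed.

Lemma segment_nonempty (G : sgraph) (F : {set {set G}}) :
  F \in segments G -> F != set0.
Proof.
case/segmentsP=> x [[|y p] [sp ->]]; first by case/andP: sp.
by apply/set0Pn; exists [set x; y]; rewrite inE /= inE eqxx.
Qed.

Lemma segments_trivIset (G : sgraph) : trivIset (segments G).
Proof.
apply/trivIsetP=> F F' sF sF'; apply: contraNT.
case/pred0Pn=> e /andP[/= eF eF'].
by rewrite (segments_class sF eF) -(segments_class sF' eF').
Qed.

Lemma cover_segments (G : sgraph) : is_tree G -> cover (segments G) = edges G.
Proof.
move=> tG; apply/setP=> e; apply/bigcupP/idP => [[F]|].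
  case/segmentsP=> x [p [/and5P[_ xp _ _ _] ->]].
  exact: subsetP (path_edges_sub xp) _.
by case/(edge_in_segment tG) => F; exists F.
Qed.

Lemma sum_segment_sequence (G : sgraph) (f : nat -> nat) :
  \sum_(i <- segment_sequence G) f i = \sum_(F in segments G) f #|F|.
Proof.
rewrite /segment_sequence (perm_big _ (permEl (perm_sort _ _))).
by rewrite big_map big_enum.
Qed.

Lemma tree_order_segments (G : sgraph) :
  is_tree G -> #|G| = (\sum_(i <- segment_sequence G) i).+1.
Proof.
move=> tG; rewrite tree_order // (sum_segment_sequence G id).
by rewrite -cover_segments //; congr _.+1; apply/esym/eqP/segments_trivIset.
Qed.

(** * The contribution of a segment *)

(** Crossing a vertex of degree 2 moves exactly that vertex to the other
    side. *)
Lemma side_step (G : sgraph) (x y z : G) :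
  is_tree G -> adj x y -> adj y z -> x != z -> degree y = 2 ->
  side y z = y |: side x y.
Proof.
move=> tG xy yz xz dy; have [cG acG] := tG; have yx : adj y x by rewrite adj_sym.
have zy : z \notin side x y.
  apply: contra (side_opp tG xy); rewrite !inE => h.
  apply: (connect_trans h); apply: connect1.
  rewrite /del_edge /= adj_sym yz; apply/eqP=> /set2_inj [] [] E1 E2.
    by rewrite E1 eqxx in xz.
  by have := adj_neq yz; rewrite E1 eqxx.
apply: side_eq => // [|| u v]; first exact: setU11.
  by rewrite in_setU1 negb_or eq_sym adj_neq.
rewrite in_setU1 => /predU1P[-> /andP[yv ne]|uA uv].
  have [->|vz] := degree2_nbrs dy yx yz xz yv; first by rewrite !inE connect0 orbT.
  by rewrite vz eqxx in ne.
case/andP: uv => uv _; have [E|ne] := eqVneq [set u; v] [set x; y].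
  have := set22 u v; rewrite E !inE.
  by case/orP=> /eqP->; rewrite ?eqxx ?connect0 ?orbT.
rewrite in_setU1; apply/orP; right; move: uA; rewrite !inE => h.
by apply: (connect_trans h); apply: connect1; rewrite /del_edge /= uv.
Qed.

(** By [side_step] the sides met along a segment have consecutive sizes. *)
Lemma path_sep_count (G : sgraph) (k : nat) (x y : G) p :
  is_tree G -> 0 < k ->
  path (@adj G) x (y :: p) -> uniq (x :: y :: p) ->
  all (fun v => degree v == 2) (belast y p) ->
  [/\ \sum_(e <- pairmap (fun u v => [set u; v]) x (y :: p)) sep_count k e
      + \sum_(j < (size p).+1) one_sided #|G| k (#|side x y| + j)
      = (size p).+1 * 'C(#|G|, k),
      #|side x y| + (size p).+1 <= #|G|
    & leaf (last y p) -> #|side x y| + (size p).+1 = #|G|].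
Proof.
move=> tG k0; have [cG acG] := tG.
elim: p x y => [|z p IH] x y.
  rewrite /= andbT => xy _ _.
  rewrite big_seq1 big_ord1 addn0 mul1n sep_countE //; split=> //.
    rewrite addn1 -(cardsC (side x y)) -sideC // -addn1 leq_add2l.
    exact: side_gt0.
  move=> /cards1P[w wE]; rewrite -(cardsC (side x y)) -sideC //; congr (_ + _).
  have nbr u : adj y u -> u = x.
    have : x \in [set u | adj y u] by rewrite inE adj_sym.
    rewrite wE => /set1P -> yu; apply/set1P; by rewrite -wE inE.
  rewrite (side_eq (A := [set y])) ?cards1 ?set11 //; first by rewrite adj_sym.
    by rewrite inE adj_neq.
  by move=> u v /set1P-> /andP[/nbr -> ]; rewrite eqxx.
move=> /= /and3P[xy yz zp] uq /andP[/eqP dy dp].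
have xz : x != z by move: uq; rewrite !inE !negb_or => /andP[/and3P[]].
have yx : y \notin side x y := side_opp tG xy.
have [|||E le lf] := IH y z; rewrite //= ?yz //; first by case/andP: uq.
have aE : #|side y z| = #|side x y|.+1 by rewrite (side_step tG xy) // cardsU1 yx.
rewrite big_cons big_ord_recl addn0 addnACA sep_countE // mulSn.
move: E le lf; rewrite aE !addSnnS => E le lf; split=> //.
rewrite -E; congr (_ + (_ + _)); apply: eq_bigr => j _.
by rewrite addSnnS.
Qed.

(** The contribution to SW_k, in a tree of order [n], of a segment of length [l]
    with a leaf end: the component away from the leaf has [n - l] vertices at
    the first edge. *)
Definition segment_cost (n k l : nat) : nat :=
  l * 'C(n, k) - \sum_(j < l) one_sided n k (n - l + j).

Lemma sum_path_edges (G : sgraph) (x : G) p (f : {set G} -> nat) :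
  uniq (x :: p) ->
  \sum_(e in path_edges x p) f e
  = \sum_(e <- pairmap (fun u v => [set u; v]) x p) f e.
Proof.
move/uniq_path_edges=> uq; rewrite [RHS]big_uniq //=.
by apply: eq_bigl => e; rewrite inE.
Qed.

Lemma segment_cost_path (G : sgraph) (k : nat) (x : G) p :
  is_tree G -> 0 < k -> is_segment x p ->
  segment_cost #|G| k (size p) <= \sum_(e in path_edges x p) sep_count k e
  /\ (leaf (last x p) ->
      \sum_(e in path_edges x p) sep_count k e = segment_cost #|G| k (size p)).
Proof.
move=> tG k0 /and5P[p0 xp uq dp _]; rewrite sum_path_edges //.
case: p p0 xp uq dp => // y p _ xp uq dp.
have [E le lf] := path_sep_count tG k0 xp uq dp.
rewrite /segment_cost [size _]/=; split=> [|/lf aE].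
  by rewrite leq_subLR -E addnC leq_add2r sum_one_sided_le // side_gt0.
have -> : #|G| - (size p).+1 = #|side x y| by rewrite -aE addnK.
by rewrite -E addnK.
Qed.

Lemma steiner_wiener_segments (G : sgraph) (k : nat) :
  is_tree G -> 0 < k ->
  steiner_wiener G k
  = \sum_(F in segments G) \sum_(e in F) sep_count k e.
Proof.
move=> tG k0; rewrite tree_steiner_wiener // -cover_segments //.
exact/big_trivIset/segments_trivIset.
Qed.

Lemma steiner_wiener_lower (G : sgraph) (k : nat) :
  is_tree G -> 0 < k ->
  \sum_(i <- segment_sequence G) segment_cost #|G| k i <= steiner_wiener G k.
Proof.
move=> tG k0; rewrite steiner_wiener_segments // sum_segment_sequence.
apply: leq_sum => F /segmentsP[x [p [sp ->]]].
have /and5P[_ _ uq _ _] := sp; rewrite card_path_edges //.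
by case: (segment_cost_path tG k0 sp).
Qed.

Lemma steiner_wiener_leafy (G : sgraph) (k : nat) :
  is_tree G -> 0 < k ->
  (forall F, F \in segments G -> exists x p,
     [/\ is_segment x p, leaf (last x p) & F = path_edges x p]) ->
  steiner_wiener G k = \sum_(i <- segment_sequence G) segment_cost #|G| k i.
Proof.
move=> tG k0 lG; rewrite steiner_wiener_segments // sum_segment_sequence.
apply: eq_bigr => F /lG[x [p [sp lp ->]]].
have /and5P[_ _ uq _ _] := sp; rewrite card_path_edges //.
by case: (segment_cost_path tG k0 sp) => _; exact.
Qed.

(** * The number of segments of a tree *)

(** A path that never returns to its start leaves it along one edge only. *)
Lemma start_edge (G : sgraph) (x y u : G) p :
  uniq (x :: y :: p) -> [set x; u] \in path_edges x (y :: p) -> u = y.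
Proof.
case/andP=> xp _; rewrite inE /= inE => /orP[/eqP|h].
  by case/set2_inj=> [[_ ->]|[-> ->]].
move: xp; rewrite (@path_edges_vertex _ y p [set x; u] x) ?set21 //.
by rewrite inE.
Qed.

(** A branch vertex can only be an end of a segment, so the edges at it lie on
    different segments. *)
Lemma segment_branch (G : sgraph) (F : {set {set G}}) (v u w : G) :
  F \in segments G -> branch v ->
  [set v; u] \in F -> [set v; w] \in F -> u = w.
Proof.
case/segmentsP=> x [p [/and5P[p0 xp uq dp _] ->]] bv uF wF.
have start (y : G) (q : seq G) :
    deg2_path v (y :: q) -> [set v; u] \in path_edges v (y :: q) ->
    [set v; w] \in path_edges v (y :: q) -> u = w.
  by case/and4P=> _ _ uq' _ /(start_edge uq') -> /(start_edge uq') ->.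
have ap : deg2_path x p by rewrite /deg2_path p0 xp uq.
have [ar _ /subsetP sub] := deg2_path_rev ap.
have := path_edges_vertex uF (set21 v u); rewrite inE => /orP[/eqP vx|vp].
  by case: p p0 {xp uq dp ar sub} ap uF wF => // y q _; rewrite -vx; exact: start.
case/lastP: p p0 {xp uq ap} dp vp ar uF wF sub => // m z _ dp vp ar uF wF sub.
move: vp; rewrite mem_rcons inE => /orP[/eqP vz|vm].
  move: (sub _ uF) (sub _ wF) ar.
  rewrite belast_rcons rev_cons last_rcons -vz.
  case: (rev m) => [|a q] /= uR wR ar; first exact: start ar uR wR.
  exact: start ar uR wR.
move: dp bv; rewrite belast_rcons => /allP/(_ _ vm)/eqP.
by rewrite /branch => ->.
Qed.

(** At a branch vertex at least three segments end. Without branch vertices, any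
    two distinct edges with a common vertex are linked, so by connectedness all
    edges form a single class. *)
Lemma card_segments_neq2 (G : sgraph) : is_tree G -> #|segments G| != 2.
Proof.
move=> tG; have [cG acG] := tG.
case: (boolP [exists v : G, branch v]) => [/existsP[v bv]|nb].
  have in_seg u : adj v u -> [set v; u] \in cover (segments G).
    by move=> vu; rewrite cover_segments // adj_edge.
  have inj : {in [set u | adj v u] &,
               injective (fun u => pblock (segments G) [set v; u])}.
    move=> u w; rewrite !inE => vu vw E.
    apply: (segment_branch (F := pblock (segments G) [set v; u]) _ bv).
    - by rewrite pblock_mem // in_seg.
    - by rewrite mem_pblock in_seg.
    - by rewrite E mem_pblock in_seg.
  rewrite neq_ltn orbC; apply/orP; left; apply: (leq_trans bv).
  rewrite /degree -(card_in_imset inj).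
  apply/subset_leq_card/subsetP=> F /imsetP[u]; rewrite inE => vu ->.
  by rewrite pblock_mem // in_seg.
apply/negP=> /cards2P[F1 [F2 [ne sE]]].
have s1 : F1 \in segments G by rewrite sE set21.
have s2 : F2 \in segments G by rewrite sE set22.
have /set0Pn[e1 e1F] := segment_nonempty s1.
have /set0Pn[e2 e2F] := segment_nonempty s2.
have seg_edges F e : F \in segments G -> e \in F -> e \in edges G.
  by move=> sF eF; rewrite -cover_segments //; apply/bigcupP; exists F.
(* Without branch vertices, [A] is closed under adjacency. *)
pose A :=
  [set z | [forall f in edges G, (z \in f) ==> connect (@linked G) e1 f]].
have inA (e : {set G}) z :
    e \in edges G -> z \in e -> connect (@linked G) e1 e -> z \in A.
  move=> eE ze e1e; rewrite inE; apply/forall_inP=> f fE; apply/implyP=> zf.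
  apply: (connect_trans e1e); have [->|nef] := eqVneq e f; first exact: connect0.
  apply: connect1; rewrite /linked /= eE fE /=; apply/existsP; exists z.
  rewrite ze zf !andbT eqn_leq.
  have -> : degree z <= 2.
    by move/existsPn/(_ z): nb; rewrite /branch -ltnNge.
  have other (g : {set G}) :
      g \in edges G -> z \in g -> exists2 c, adj z c & g = [set z; c].
    case/edgesP=> a [b [ab ->]]; rewrite !inE => /orP[] /eqP->; first by exists b.
    by exists a; rewrite 1?adj_sym // setUC.
  have [c zc eC] := other _ eE ze; have [d zd fD] := other _ fE zf.
  have cd : c != d by apply: contraNneq nef => cd; rewrite eC fD cd.
  have : #|[set c; d]| <= degree z; last by rewrite cards2 cd.
  by apply/subset_leq_card/subsetP=> t; rewrite !inE => /orP[] /eqP->.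
have clA : closed (@adj G) (mem A).
  apply: intro_closed => [|u v uv]; first exact/sym_connect_sym/adj_sym.
  rewrite inE => /forall_inP/(_ _ (adj_edge uv)); rewrite set21 /= => h.
  by apply: inA h; rewrite ?adj_edge ?set22.
have e1E := seg_edges _ _ s1 e1F; have e2E := seg_edges _ _ s2 e2F.
case/edgesP: (e1E) => x [x' [_ e1x]]; case/edgesP: (e2E) => y [y' [_ e2y]].
have xA : x \in A by apply: (inA e1); rewrite ?connect0 // e1x set21.
have : y \in A by rewrite -(closed_connect clA (cG.2 x y)).
rewrite inE => /forall_inP/(_ _ e2E); rewrite {1}e2y set21 /= => h.
have : e2 \in F1 by rewrite (segments_class s1 e1F) inE.
move=> e2F1; case/eqP: ne.
by rewrite (segments_class s1 e2F1) -(segments_class s2 e2F).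
Qed.

(** * Starlike trees *)

Section StarlikeTree.
Variable l : seq nat.
Implicit Types (i : 'I_(size l)) (n : nat) (u v : starlike l).

(** Positions on a leg count from the centre, which is position 0 of every leg;
    positions beyond the end of the leg are sent to the centre as well. *)
Definition leg i n : starlike l :=
  if n is j.+1 then
    omap (existT (fun i => 'I_(nth 0 l i) : Type) i) (insub j)
  else None.

Definition position (v : starlike l) : nat :=
  if v is Some a then (tagged a).+1 else 0.

Lemma legS i j (h : j < nth 0 l i) :
  leg i j.+1 = Some (existT _ i (Ordinal h)).
Proof. by rewrite /leg insubT. Qed.

Lemma position_leg i n : n <= nth 0 l i -> position (leg i n) = n.
Proof. by case: n => // n h; rewrite legS. Qed.

Lemma leg_cases v : v = None \/ exists i n, n < nth 0 l i /\ v = leg i n.+1.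
Proof.
case: v => [[i j]|]; [right|by left]; exists i, j; split=> //.
by rewrite (legS (ltn_ord j)); congr (Some (existT _ _ _)); apply: val_inj.
Qed.

Lemma starlike_succ_leg i n : n < nth 0 l i ->
  starlike_succ (leg i n) (leg i n.+1).
Proof.
move=> h; rewrite (legS h); case: n h => [|n] h; first by [].
by rewrite (legS (ltnW h)) /= !eqxx.
Qed.

Lemma starlike_succ_inv u i n :
  n < nth 0 l i -> starlike_succ u (leg i n.+1) -> u = leg i n.
Proof.
move=> h; rewrite (legS h); case: (leg_cases u) => [->|[i' [n' [h' ->]]]].
  by move/eqP => /= ->.
rewrite (legS h') /= => /andP[/eqP E]; subst i' => /eqP nE.
by rewrite -(legS h'); congr leg.
Qed.

Lemma starlike_edgeP u v :
  adj u v -> exists i n, n < nth 0 l i /\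
    (u = leg i n /\ v = leg i n.+1 \/ u = leg i n.+1 /\ v = leg i n).
Proof.
suff H u' v' : starlike_succ u' v' ->
    exists i n, n < nth 0 l i /\ u' = leg i n /\ v' = leg i n.+1.
  by case/orP=> /H[i [n [h [E1 E2]]]]; exists i, n; auto.
move=> uv; case: (leg_cases v') => [vE|[i [n [h vE]]]].
  by move: uv; rewrite vE; case: u'.
exists i, n; split=> //; split=> //.
by apply: starlike_succ_inv => //; rewrite -vE.
Qed.

Lemma adj_leg i n : n < nth 0 l i -> @adj (starlike l) (leg i n) (leg i n.+1).
Proof. by move=> h; apply/orP; left; exact: starlike_succ_leg. Qed.

Lemma leg_inj i i' n n' : n < nth 0 l i -> n' < nth 0 l i' ->
  leg i n.+1 = leg i' n'.+1 -> i = i' /\ n = n'.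
Proof.
move=> h h' E; split; last first.
  by have := congr1 position E; rewrite !position_leg // => -[].
move: E; rewrite (legS h) (legS h').
by move/(congr1 (fun v => if v is Some a then tag a else i)).
Qed.

Lemma leg_nbrs i n v : n < nth 0 l i -> adj (leg i n.+1) v ->
  v = leg i n \/ n.+1 < nth 0 l i /\ v = leg i n.+2.
Proof.
move=> h /starlike_edgeP[i' [n' [h' [[E ->]|[E ->]]]]].
  case: n' h' E => [|n'] h' E; first by have := congr1 position E; rewrite position_leg.
  by case: (leg_inj h (ltnW h') E) => ? ?; subst i' n'; right.
by case: (leg_inj h h' E) => ? ?; subst i' n'; left.
Qed.

(** Every edge is a bridge, because the part of a leg beyond an edge can be left
    only through that edge. *)
Lemma starlike_is_tree : is_tree (starlike l).
Proof.
split; [split|]; first by apply/card_gt0P; exists None.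
  have to_centre v : connect (@adj (starlike l)) None v.
    case: (leg_cases v) => [->|[i [n [h ->]]]]; first exact: connect0.
    elim: n.+1 h => [|m IH] h; first exact: connect0.
    by apply: (connect_trans (IH (ltnW h))); apply/connect1/adj_leg.
  move=> u v; apply: connect_trans (to_centre v).
  by rewrite (sym_connect_sym (@adj_sym (starlike l))); exact: to_centre.
apply: bridges_acyclic => x y /starlike_edgeP[i [n [h xy]]].
set e := [set x; y].
have eE : e = [set leg i n; leg i n.+1].
  by rewrite /e; case: xy => [] [-> ->]; rewrite 1?setUC.
suff nc : ~~ connect (del_edge e) (leg i n.+1) (leg i n).
  by case: xy => [] [-> ->]; rewrite // connect_del_sym.
pose D := [set leg i m.+1 | m : 'I_(nth 0 l i) & n <= m].
have inD m : n <= m < nth 0 l i -> leg i m.+1 \in D.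
  by case/andP=> nm ml; apply/imsetP; exists (Ordinal ml); rewrite ?inE.
have cl : closed (del_edge e) (mem D).
  apply: intro_closed => [|u v uv]; first exact: connect_del_sym.
  case/imsetP=> -[m hm] /=; rewrite inE /= => nm uE; subst u.
  case/andP: uv => uv ne; case: (leg_nbrs hm uv) => [vE|[hm' ->]]; last first.
    by apply: inD; rewrite hm' leqW.
  move: nm; rewrite leq_eqVlt => /predU1P[nm|]; last first.
    case: m hm {uv ne} vE => // m hm -> nm.
    by apply: inD; rewrite -ltnS nm ltnW.
  by move: ne; rewrite eE vE nm setUC eqxx.
apply/negP=> /(closed_connect cl); rewrite inD ?leqnn //.
move/esym/imsetP=> -[[m hm]]; rewrite inE /= => nm /(congr1 position).
by rewrite (position_leg (ltnW h)) (position_leg hm) => nE; rewrite nE ltnn in nm.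
Qed.

(** * The legs are the segments *)

Definition leg_path i : seq (starlike l) := map (leg i) (iota 1 (nth 0 l i)).

Lemma last_iota a b : last a (iota a.+1 b) = a + b.
Proof. by elim: b a => [|b IH] a /=; rewrite ?addn0 // IH addSnnS. Qed.

Lemma belast_iota a b : belast a (iota a.+1 b) = iota a b.
Proof. by elim: b a => [//|b IH] a /=; rewrite IH. Qed.

Lemma degree_leg_inner i n : n.+1 < nth 0 l i -> degree (leg i n.+1) = 2.
Proof.
move=> h; have h' := ltnW h; rewrite /degree.
have -> : [set v | adj (leg i n.+1) v] = [set leg i n; leg i n.+2].
  apply/setP=> v; rewrite !inE; apply/idP/orP => [/(leg_nbrs h')[->|[_ ->]]|].
  - by left.
  - by right.
  by case=> /eqP ->; [rewrite adj_sym|]; exact: adj_leg.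
rewrite cards2; case: eqP => // /(congr1 position).
by rewrite (position_leg (ltnW h')) (position_leg h); lia.
Qed.

Lemma leaf_leg_end i : 0 < nth 0 l i -> leaf (leg i (nth 0 l i)).
Proof.
case E: (nth 0 l i) => [//|n] _; have h : n < nth 0 l i by rewrite E.
apply/cards1P; exists (leg i n); apply/setP=> v; rewrite !inE.
apply/idP/eqP => [/(leg_nbrs h)[//|[]]|->]; first by rewrite E ltnn.
by rewrite adj_sym; exact: adj_leg.
Qed.

Lemma degree_centre :
  (forall i, 0 < nth 0 l i) -> degree (None : starlike l) = size l.
Proof.
move=> pos; rewrite -[RHS]card_ord /degree.
have inj : injective (fun i => leg i 1).
  by move=> i i' /leg_inj; case=> //; exact: pos.
rewrite -(card_imset _ inj); apply: eq_card => v; rewrite !inE.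
apply/idP/imsetP => [|[i _ ->]]; last exact: (adj_leg (pos i)).
case/starlike_edgeP=> i [n [h [[E ->]|[E _]]]].
  exists i => //; case: n h E => // n h E.
  by have := congr1 position E; rewrite position_leg // ltnW.
by have := congr1 position E; rewrite position_leg.
Qed.

Lemma leg_segment i : (forall i', 0 < nth 0 l i') -> size l != 2 ->
  is_segment (leg i 0) (leg_path i) /\ leaf (last (leg i 0) (leg_path i)).
Proof.
move=> pos sz; have li := pos i.
have lastE : last (leg i 0) (leg_path i) = leg i (nth 0 l i).
  by rewrite /leg_path (last_map (leg i)) last_iota.
split; last by rewrite lastE leaf_leg_end.
apply/and5P; split.
- by rewrite -size_eq0 size_map size_iota -lt0n.
- have : forall a b, a + b <= nth 0 l i ->
      path (@adj (starlike l)) (leg i a) (map (leg i) (iota a.+1 b)).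
    move=> a b; elim: b a => [//|b IH] a h.
    by apply/andP; split; [apply: adj_leg | apply: IH]; lia.
  by apply.
- rewrite /leg_path -(map_cons (leg i)) map_inj_in_uniq ?(iota_uniq 0 _.+1) //.
  move=> a b; rewrite -/(iota 0 _.+1) !mem_iota => ha hb /(congr1 position).
  by rewrite !position_leg.
- rewrite /leg_path belast_map belast_iota.
  case E: (nth 0 l i) => [//|n] /=.
  apply/allP=> v /mapP[m]; rewrite mem_iota; case: m => // m hm ->.
  by rewrite degree_leg_inner // E; lia.
apply/andP; split; last by rewrite lastE leaf_leg_end.
have m0 := leq_ltn_trans (leq0n i) (ltn_ord i).
rewrite /leaf /branch (degree_centre pos).
by move: sz m0; case: (size l) => [|[|[]]].
Qed.

Lemma leg_edge i n : n < nth 0 l i ->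
  [set leg i n; leg i n.+1] \in path_edges (leg i 0) (leg_path i).
Proof.
move=> h; apply/path_edgesP.
exists (map (leg i) (iota 1 n)), (leg i n.+1),
  (map (leg i) (iota n.+2 (nth 0 l i - n.+1))).
rewrite (last_map (leg i)) last_iota; split=> //.
rewrite -map_cons -map_cat -/(iota n.+1 _.+1) -{2}[n.+1]add1n -iotaD.
by rewrite subnSK // subnKC // ltnW.
Qed.

(** The legs are segments that cover all the edges, and a segment is determined
    by any of its edges, so there are no others. *)
Lemma starlike_segments :
  (forall i, 0 < nth 0 l i) -> size l != 2 ->
  segments (starlike l)
  = [set path_edges (leg i 0) (leg_path i) | i : 'I_(size l)].
Proof.
move=> pos sz; apply/setP=> F; apply/idP/imsetP => [sF|[i _ ->]]; last first.
  by apply/segmentsP; exists (leg i 0), (leg_path i); case: (leg_segment i pos sz).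
have /set0Pn[e eF] := segment_nonempty sF.
have : e \in edges (starlike l).
  by rewrite -(cover_segments starlike_is_tree); apply/bigcupP; exists F.
case/edgesP=> u [v [/starlike_edgeP[i [n [h uv]]] eE]].
exists i => //; have [si _] := leg_segment i pos sz.
rewrite (segments_class sF eF) (segment_class (e := e) si) // eE.
by have := leg_edge h; case: uv => [] [-> ->] //; rewrite setUC.
Qed.

Lemma starlike_segment_sequence :
  sorted geq l -> (forall i, 0 < nth 0 l i) -> size l != 2 ->
  segment_sequence (starlike l) = l.
Proof.
move=> srt pos sz; rewrite /segment_sequence.
have geq_trans : transitive geq by move=> a b c /= ba cb; exact: leq_trans cb ba.
have geq_anti : antisymmetric geq by move=> a b; rewrite /= andbC => /anti_leq.
have geq_total : total geq by move=> a b; exact: leq_total.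
apply: (sorted_eq geq_trans geq_anti) => //; first exact: sort_sorted.
rewrite perm_sort.
pose F i := path_edges (leg i 0) (leg_path i).
have Finj : injective F.
  move=> i i' E; have := leg_edge (pos i); rewrite -/(F i) E => h.
  have := path_edges_vertex h (set22 _ _); rewrite inE.
  case/predU1P=> [/(congr1 position)|/mapP[[|n]]]; first by rewrite position_leg.
    by rewrite mem_iota.
  rewrite mem_iota => hn E'; have hn' : n < nth 0 l i' by lia.
  by case: (leg_inj (pos i) hn' E').
have pE : perm_eq (enum (segments (starlike l))) (map F (enum 'I_(size l))).
  apply: uniq_perm; rewrite ?enum_uniq ?(map_inj_uniq Finj) ?enum_uniq //.
  move=> X; rewrite mem_enum starlike_segments //.
  by apply/imsetP/mapP => [[i _ ->]|[i _ ->]]; exists i; rewrite ?mem_enum.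
apply: (perm_trans (perm_map _ pE)); rewrite -map_comp.
have -> // : map ((fun X : {set {set starlike l}} => #|X|) \o F)
               (enum 'I_(size l)) = l.
rewrite -[RHS](mkseq_nth 0) /mkseq -val_enum_ord -map_comp.
apply: eq_map => i; have [/and5P[_ _ uq _ _] _] := leg_segment i pos sz.
by rewrite [LHS](card_path_edges uq) size_map size_iota.
Qed.

End StarlikeTree.

Lemma tree_class_sequence (G : sgraph) (l : seq nat) :
  tree_class l G ->
  [/\ sorted geq l, forall i : 'I_(size l), 0 < nth 0 l i & size l != 2].
Proof.
case=> tG <-; split.
- by apply: sort_sorted => a b; exact: leq_total.
- move=> i; have := mem_nth 0 (ltn_ord i); rewrite mem_sort => /mapP[F].
  by rewrite mem_enum => /segment_nonempty; rewrite -card_gt0 => ? ->.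
by rewrite size_sort size_map -cardE card_segments_neq2.
Qed.

Theorem theorem1p1 (l : seq nat) (k : nat)
    (hl : exists G : sgraph, tree_class l G) (hk : 0 < k) :
  tree_class l (starlike l) /\
  forall T : sgraph, tree_class l T ->
    steiner_wiener (starlike l) k <= steiner_wiener T k.
Proof.
have [G /tree_class_sequence[srt pos sz]] := hl.
have tS := starlike_is_tree l.
have sS := starlike_segment_sequence srt pos sz.
split=> // T [tT sT].
have nE : #|starlike l| = #|T| by rewrite !tree_order_segments // sS sT.
have -> : steiner_wiener (starlike l) k = \sum_(i <- l) segment_cost #|T| k i.
  rewrite steiner_wiener_leafy // ?sS ?nE // => F.
  rewrite starlike_segments // => /imsetP[i _ ->].
  by have [? ?] := leg_segment i pos sz; exists (leg i 0), (leg_path i).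
by rewrite -sT; exact: steiner_wiener_lower.
Qed.
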